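(* Let $\langle X,d\rangle$ be an $\mathbb{R}$-tree. The following are equivalent: (1) $X$ is separable and has only countably many noncut-points; (2) for every $p\in X$, the cut-point order on $X$ with root $p$ is countably wispy and has only countably many terminal nodes; (3) for every $p\in X$, the cut-point order on $X$ with root $p$ is ccc.
   Context: An $\mathbb{R}$-tree is a metric space $\langle X,d\rangle$ such that between any two points $x,y$ there is a unique arc (image of a topological embedding of a real interval $[a,b]$ sending $a\mapsto x$, $b\mapsto y$), denoted $[x,y]$, and this arc is the image of an isometric embedding. The cut-point order with root $p$ is defined by $x\le y$ iff $[p,x]\subseteq[p,y]$. A noncut-point of a connected space $X$ is a point $x$ with $X\setminus\{x\}$ connected. For $x$ in a tree order, the $x$-connected components are the equivalence classes of $\{y\mid y>x\}$ under $y\sim_x z$ iff there is $w>x$ with $w\le y,z$; $x$ is terminal if there are no such components (no element above $x$), and branching if there is more than one. A twig is a maximal upwards-closed subset order-isomorphic to a non-trivial real interval. The order is countably wispy if it has at most countably many branching nodes and at most countably many twigs. An antichain is a set of pairwise incomparable elements; a tree order is ccc if it has no uncountable antichain. *)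

(* Defs.v *)
From HB Require Import structures.
From mathcomp Require Import all_boot all_order all_algebra.
From mathcomp Require Import all_classical all_reals all_analysis.

Set Implicit Arguments.
Unset Strict Implicit.
Unset Printing Implicit Defensive.

Import Order.TTheory GRing.Theory Num.Theory.
Import numFieldTopology.Exports numFieldNormedType.Exports.

Local Open Scope classical_set_scope.
Local Open Scope ring_scope.

Definition topological_embedding_on (S T : topologicalType)
    (A : set S) (f : S -> T) : Prop :=
  [/\ {within A, continuous f}, set_inj A f &
      exists g : T -> S,
        (forall s, A s -> g (f s) = s) /\ {within f @` A, continuous g}].

(* "Separable" is absent from the library. *)
Definition separable_space (T : topologicalType) : Prop :=
  exists A : set T, countable A /\ dense A.

Definition noncut_point (T : topologicalType) (x : T) : Prop :=
  connected (~` [set x]).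

Section RTree.
Context {R : realType} {X : metricType R}.

(* The degenerate interval a = b is allowed: the arc from x to x is {x}. *)
Definition is_arc (x y : X) (A : set X) : Prop :=
  exists (a b : R) (f : R -> X),
    [/\ a <= b, topological_embedding_on `[a, b]%classic f, f a = x, f b = y
      & A = f @` `[a, b]%classic].

Definition isometric_interval (A : set X) : Prop :=
  exists (a b : R) (f : R -> X),
    [/\ a <= b,
        (forall s t, `[a, b]%classic s -> `[a, b]%classic t ->
           mdist (f s) (f t) = `|s - t|)
      & A = f @` `[a, b]%classic].

(* [x, y]: the arc from x to y, meaningful when it exists and is unique;
   [xget] is a definite description with default value the empty set. *)
Definition tree_arc (x y : X) : set X := xget set0 [set A | is_arc x y A].

Definition cut_le (p x y : X) : Prop := tree_arc p x `<=` tree_arc p y.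

End RTree.

Definition R_tree (R : realType) (X : metricType R) : Prop :=
  forall x y : X,
    (exists! A : set X, is_arc x y A) /\ isometric_interval (tree_arc x y).

Section TreeOrder.
Context {X : Type}.
Variable le : X -> X -> Prop.

Definition strictly_below (x y : X) : Prop := le x y /\ x <> y.

Definition same_component (x y z : X) : Prop :=
  exists w, [/\ strictly_below x w, le w y & le w z].

Definition components (x : X) : set (set X) :=
  [set C | exists2 y, strictly_below x y
             & C = [set z | strictly_below x z /\ same_component x y z]].

Definition terminal (x : X) : Prop := components x = set0.

Definition branching (x : X) : Prop :=
  exists C D, [/\ components x C, components x D & C <> D].

Definition upwards_closed (A : set X) : Prop :=
  forall x y, A x -> le x y -> A y.

(* The interval may be open, closed or half-open, bounded or not. *)
Definition iso_to_real_interval (R : realType) (A : set X) : Prop :=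
  exists (I : set R) (f : R -> X),
    [/\ is_interval I,
        (exists s t, [/\ I s, I t & s < t]),
        set_bij I A f
      & forall s t, I s -> I t -> (le (f s) (f t) <-> s <= t)].

Definition twig (R : realType) (A : set X) : Prop :=
  [/\ upwards_closed A, iso_to_real_interval R A
    & forall B : set X, upwards_closed B -> iso_to_real_interval R B ->
        A `<=` B -> B = A].

Definition countably_wispy (R : realType) : Prop :=
  countable [set x | branching x] /\ countable [set A | twig R A].

Definition antichain (A : set X) : Prop :=
  forall x y, A x -> A y -> x <> y -> ~ le x y /\ ~ le y x.

Definition ccc : Prop := forall A, antichain A -> countable A.

End TreeOrder.

(* Main.v *)
Require Import Defs.
From mathcomp Require Import all_boot all_order all_algebra.
From mathcomp Require Import all_classical all_reals all_analysis.
From mathcomp Require Import lra.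

(* Uniqueness of arcs gives [x, y] = {z | d(x,z) + d(z,y) = d(x,y)}, so x <= y
   in the order with root p iff d(p,x) + d(x,y) = d(p,y), and the height
   d(p, .) is an order isomorphism onto an interval on every convex chain.
   Everything is compared with ccc, for one fixed root.
   - Points of equal height form an antichain, so under ccc the points of
     rational height form a countable set, which is dense.  Two of its points
     determine a branching node separating them, one determines the twig
     through it.
   - Conversely an element of an antichain is terminal, or lies below a
     branching node, or has a nontrivial chain above it and so lies in a twig;
     no two elements of the antichain share such a node or twig.
   - Away from the root, noncut-points are the terminal nodes; the sets
     {y | y > x} are open, and disjoint when x runs through an antichain. *)

Set Implicit Arguments.
Unset Strict Implicit.
Unset Printing Implicit Defensive.

Import Order.TTheory GRing.Theory Num.Theory.
Import numFieldTopology.Exports numFieldNormedType.Exports.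

Local Open Scope classical_set_scope.
Local Open Scope ring_scope.

(** * Countability and continuity tools *)

(** Choosing a related [b] for each [a] is injective because [r] determines [a]. A relation lets
    each counting argument name its witnesses without choosing them. *)
Lemma countable_sub_rel {T U : Type} (A : set T) (B : set U)
    (r : T -> U -> Prop) :
  countable B -> (forall a, A a -> exists2 b, B b & r a b) ->
  (forall a a' b, A a -> A a' -> r a b -> r a' b -> a = a') -> countable A.
Proof.
move=> /countable_injP[g ginj] rex runiq; apply/countable_injP.
have /choice[f fP] : forall a, exists n, A a -> exists b, [/\ B b, r a b & g b = n].
  move=> a; have [/rex[b Bb rab]|nAa] := pselect (A a); last by exists 0%N.
  by exists (g b) => _; exists b.
exists f => a a' /set_mem Aa /set_mem Aa' faa'.
have [b [Bb rab gb]] := fP _ Aa; have [b' [Bb' rab' gb']] := fP _ Aa'.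
apply: (runiq _ _ b) => //; suff -> : b = b' by [].
by apply: ginj; rewrite ?inE// gb gb'.
Qed.

Lemma countableU {T : Type} (A B : set T) :
  countable A -> countable B -> countable (A `|` B).
Proof.
move=> cA cB; have -> : A `|` B = \bigcup_b (if b then A else B).
  apply/seteqP; split => [x [Ax|Bx]|x [[] _ /=]].
  - by exists true.
  - by exists false.
  - by left.
  - by right.
by apply: bigcup_countable => [|[]].
Qed.

Lemma subset_countable {T : Type} (A B : set T) :
  A `<=` B -> countable B -> countable A.
Proof. by move=> /subset_card_le /sub_countable; apply. Qed.

Lemma within_nonexpansive_continuous (R : realType) (M N : pseudoMetricType R)
    (A : set M) (f : M -> N) :
  (forall x y e, A x -> A y -> ball x e y -> ball (f x) e (f y)) ->
  {within A, continuous f}.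
Proof.
move=> fA; apply/subspace_continuousP => x Ax.
apply/cvg_ballP => e e0.
have : \forall y \near x, ball x e y by exact: nbhsx_ballx.
by apply: filterS => y xy Ay; exact: fA.
Qed.

(** * Arcs and geodesics *)

Section Metric.
Context {R : realType} {X : metricType R}.
Implicit Types x y z w p : X.

(** Parametrised by the distance from [x], so that [mdist x] inverts it; [isometric_interval] fixes
    neither the parameters nor the direction. *)
Definition geodesic x y (f : R -> X) : Prop :=
  [/\ f 0 = x, f (mdist x y) = y
    & forall s t, 0 <= s <= mdist x y -> 0 <= t <= mdist x y ->
        mdist (f s) (f t) = `|s - t|].

Lemma mdist_diff_le x y z : `|mdist x y - mdist x z| <= mdist y z.
Proof.
have := metric_triangle x y z; have := metric_triangle x z y.
rewrite (metric_sym z y) => h1 h2; rewrite ler_norml; apply/andP; split; lra.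
Qed.

Lemma mdist_continuous x : continuous (mdist x : X -> R).
Proof.
move=> y; apply/cvg_ballP => e e0.
have : \forall z \near y, ball y e z by exact: nbhsx_ballx.
apply: filterS => z; rewrite ballEmdist -ball_normE /=.
exact: le_lt_trans (mdist_diff_le _ _ _).
Qed.

Lemma isometric_continuous (A : set R) (f : R -> X) :
  (forall s t, A s -> A t -> mdist (f s) (f t) = `|s - t|) ->
  {within A, continuous f}.
Proof.
move=> fA; apply: within_nonexpansive_continuous => s t e As At.
by rewrite ballEmdist -ball_normE /= fA.
Qed.

Lemma geodesic_dist x y f s : geodesic x y f -> 0 <= s <= mdist x y ->
  mdist x (f s) = s /\ mdist (f s) y = mdist x y - s.
Proof.
move=> [f0 fd fi] sxy; have /andP[s0 sd] := sxy; have d0 := mdist_ge0 x y.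
split; first by rewrite -[in LHS]f0 fi ?lexx// sub0r normrN ger0_norm.
by rewrite -[X in mdist _ X = _]fd fi ?lexx ?andbT// distrC ger0_norm// subr_ge0.
Qed.

Lemma geodesic_arc x y f : geodesic x y f ->
  is_arc x y (f @` `[0, mdist x y]).
Proof.
move=> gf; have [f0 fd fi] := gf.
exists 0, (mdist x y), f; split => //; first exact: mdist_ge0.
have E s : `[0, mdist x y]%classic s -> 0 <= s <= mdist x y by rewrite /= in_itv.
split.
- by apply: isometric_continuous => s t /E ? /E ?; exact: fi.
- move=> s t /set_mem/E hs /set_mem/E ht fst.
  by rewrite -(geodesic_dist gf hs).1 -(geodesic_dist gf ht).1 fst.
- exists (mdist x); split; last exact/continuous_subspaceT/mdist_continuous.
  by move=> s /E /(geodesic_dist gf)[].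
Qed.

End Metric.

Section RTree.
Context {R : realType} {X : metricType R} (hX : R_tree X).
Implicit Types x y z w p : X.

Lemma tree_arc_is_arc x y : is_arc x y (tree_arc x y).
Proof.
have [[A [Aarc _]] _] := hX x y.
exact: (@xgetPex _ set0 [set A | is_arc x y A]) (ex_intro _ A Aarc).
Qed.

Lemma is_arc_tree_arc x y A : is_arc x y A -> A = tree_arc x y.
Proof.
have [[B [_ Buniq]] _] := hX x y.
by move=> /Buniq <-; apply: Buniq; exact: tree_arc_is_arc.
Qed.

Lemma tree_arc_ends x y : tree_arc x y x /\ tree_arc x y y.
Proof.
have [a [b [f [ab _ <- <- ->]]]] := tree_arc_is_arc x y.
by split; [exists a|exists b] => //=; rewrite in_itv/= lexx ?ab.
Qed.

Lemma geodesic_exists x y : exists f, geodesic x y f.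
Proof.
have [_ [a [b [f [ab fi E]]]]] := hX x y.
have [] := tree_arc_ends x y; rewrite E => -[s sab <-] [t tab <-].
rewrite /geodesic fi//.
move: sab tab; rewrite /= !in_itv/= => /andP[as_ sb] /andP[at_ tb].
have fi' u v : a <= u <= b -> a <= v <= b -> mdist (f u) (f v) = `|u - v|.
  by move=> ? ?; apply: fi; rewrite /= in_itv.
(* According to the order of the parameters of the two ends, the given isometry is shifted or
   reflected. *)
have [st|/ltW ts] := leP s t.
- exists (fun u => f (s + u)); rewrite distrC ger0_norm ?subr_ge0//.
  split; [by rewrite addr0|by rewrite addrC subrK|].
  move=> u v /andP[? ?] /andP[? ?]; rewrite fi'; last 2 first.
  + by apply/andP; split; lra.
  + by apply/andP; split; lra.
  by rewrite opprD addrACA subrr add0r.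
- exists (fun u => f (s - u)); rewrite ger0_norm ?subr_ge0//.
  split; [by rewrite subr0|by rewrite opprB addrC subrK|].
  move=> u v /andP[? ?] /andP[? ?]; rewrite fi'; last 2 first.
  + by apply/andP; split; lra.
  + by apply/andP; split; lra.
  by rewrite [RHS]distrC; congr `|_|; lra.
Qed.

Lemma tree_arc_geodesic x y f : geodesic x y f ->
  tree_arc x y = f @` `[0, mdist x y].
Proof. by move=> /geodesic_arc/is_arc_tree_arc. Qed.

(** For the converse inclusion, geodesics from [x] to [z] and from [z] to [y] are glued into a
    geodesic; by uniqueness its image, which contains [z], is the arc. *)
Lemma tree_arcE x y :
  tree_arc x y = [set z | mdist x z + mdist z y = mdist x y].
Proof.
apply/seteqP; split => z /=.
  have [f gf] := geodesic_exists x y.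
  rewrite (tree_arc_geodesic gf) => -[s /=]; rewrite in_itv/= => hs <-.
  by have [-> ->] := geodesic_dist gf hs; rewrite addrC subrK.
move=> zxy.
have [f gf] := geodesic_exists x z; have [g gg] := geodesic_exists z y.
have xz0 := mdist_ge0 x z; have zy0 := mdist_ge0 z y.
pose k (u : R) := if u <= mdist x z then f u else g (u - mdist x z).
have [f0 fd fi] := gf; have [g0 gd gi] := gg.
(* The upper bound goes through [z]; a smaller distance would bring [x] and [y] closer than
   [mdist x y]. *)
have cross u v : 0 <= u <= mdist x z -> mdist x z < v <= mdist x y ->
    mdist (f u) (g (v - mdist x z)) = v - u.
  move=> hu /andP[v1 v2].
  have hv : 0 <= v - mdist x z <= mdist z y by apply/andP; split; lra.
  have [e1 e2] := geodesic_dist gf hu; have [e3 e4] := geodesic_dist gg hv.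
  have := metric_triangle (f u) z (g (v - mdist x z)).
  have := metric_triangle x (f u) y.
  have := metric_triangle (f u) (g (v - mdist x z)) y.
  by rewrite e1 e2 e3 e4; lra.
suff gk : geodesic x y k.
  rewrite (tree_arc_geodesic gk); exists (mdist x z).
    by rewrite /= in_itv/= xz0 -zxy lerDl.
  by rewrite /k lexx.
split.
- by rewrite /k xz0.
- rewrite /k; case: leP => [h|_]; last by rewrite -zxy addrC addKr.
  have y0 : mdist z y = 0 by lra.
  by rewrite -zxy y0 addr0 fd; exact: mdist_positivity.
- move=> u v /andP[u0 u1] /andP[v0 v1]; rewrite /k.
  case: (leP u) => hu; case: (leP v) => hv.
  + by apply: fi; apply/andP.
  + rewrite cross ?u0 ?hu ?hv// distrC ger0_norm//; lra.
  + by rewrite metric_sym cross ?v0 ?hu ?hv// ger0_norm//; lra.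
  + rewrite gi; [|by apply/andP; split; lra..].
    by rewrite opprB addrA subrK.
Qed.

Lemma arc_point x y s : 0 <= s <= mdist x y ->
  exists2 z, mdist x z = s & mdist z y = mdist x y - s.
Proof.
move=> hs; have [f gf] := geodesic_exists x y.
by exists (f s); have [] := geodesic_dist gf hs.
Qed.

(* The concatenation of two arcs meeting only at the common end is an arc;
   uniqueness of arcs makes it the geodesic. *)
Lemma concat_mdist x m y :
  (forall w, tree_arc x m w -> tree_arc m y w -> w = m) ->
  mdist x m + mdist m y = mdist x y.
Proof.
move=> meet.
have [f gf] := geodesic_exists x m; have [g gg] := geodesic_exists m y.
have a0 := mdist_ge0 x m; have b0 := mdist_ge0 m y.
set a := mdist x m in a0 *; set b := mdist m y in b0 *.
have [f0 fd fi] := gf; have [g0 gd gi] := gg; rewrite -/a -/b in fd fi gd gi.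
pose k (u : R) := if u <= a then f u else g (u - a).
have kf u : u <= a -> k u = f u by rewrite /k => ->.
have kg u : a <= u -> k u = g (u - a).
  by rewrite le_eqVlt /k => /predU1P[<-|/lt_geF ->//]; rewrite lexx fd subrr g0.
(* The inverse of [k], read off from distances; by [meet] the two arcs share only [m], where both
   formulas give [a]. *)
pose i (w : X) := if mdist x w + mdist w m == a then mdist x w else a + mdist m w.
have Exm : tree_arc x m = f @` `[0, a] by exact: tree_arc_geodesic.
have Emy : tree_arc m y = g @` `[0, b] by exact: tree_arc_geodesic.
have ixm w : tree_arc x m w -> i w = mdist x w.
  by rewrite tree_arcE /i /= => ->; rewrite eqxx.
have imy w : tree_arc m y w -> i w = a + mdist m w.
  move=> mw; rewrite /i; case: eqP => // xw.
  by rewrite (meet w)// ?mdistxx ?addr0// tree_arcE.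
have ki u : 0 <= u <= a + b -> i (k u) = u.
  move=> /andP[u0 u1]; have [ua|/ltW au] := leP u a.
    have h : 0 <= u <= a by rewrite u0.
    rewrite kf// ixm; first by have [] := geodesic_dist gf h.
    by rewrite Exm; exists u => //; rewrite /= in_itv.
  have h : 0 <= u - a <= b by apply/andP; split; lra.
  rewrite kg// imy; first by have [-> _] := geodesic_dist gg h; lra.
  by rewrite Emy; exists (u - a) => //; rewrite /= in_itv.
have Eab : `[0, a + b]%classic = `[0, a]%classic `|` `[a, a + b]%classic.
  apply/seteqP; split => u /=; rewrite !in_itv/=.
    by move=> /andP[u0 u1]; case: (leP u a) => h; [left|right]; apply/andP; split; lra.
  by case => /andP[h1 h2]; apply/andP; split; lra.
have kU : k @` `[0, a + b] = tree_arc x m `|` tree_arc m y.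
  rewrite Eab image_setU Exm Emy; congr (_ `|` _).
    by apply: eq_imagel => u /=; rewrite in_itv/= => /andP[_ /kf].
  apply/seteqP; split => [w [u]|w [u]] /=; rewrite in_itv/= => /andP[h1 h2] <-.
    exists (u - a); last by rewrite kg.
    by rewrite /= in_itv/=; apply/andP; split; lra.
  exists (a + u); last by rewrite kg ?lerDl// addrC addKr.
  by rewrite /= in_itv/=; apply/andP; split; lra.
have arc_closed p q : closed (tree_arc p q).
  have -> : tree_arc p q =
      (fun w => mdist p w + mdist q w) @^-1` [set mdist p q].
    by rewrite tree_arcE; apply/seteqP; split => w /=; rewrite (metric_sym q).
  apply: preimage_closed; last exact: closed_eq.
  by move=> w _; apply: cvgD; exact: mdist_continuous.
have karc : is_arc x y (k @` `[0, a + b]).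
  exists 0, (a + b), k; split => //.
  - exact: addr_ge0.
  - split.
    + rewrite Eab; apply: withinU_continuous; try exact: itv_closed.
        apply: isometric_continuous => s t /=; rewrite !in_itv/=.
        by move=> hs ht; rewrite !kf ?fi//; case/andP: hs ht => // ? ? /andP[].
      apply: isometric_continuous => s t /=; rewrite !in_itv/=.
      move=> /andP[? ?] /andP[? ?]; rewrite !kg// gi; last 2 first.
      * by apply/andP; split; lra.
      * by apply/andP; split; lra.
      by rewrite opprB addrA subrK.
    + move=> s t; rewrite !inE /= !in_itv/= => hs ht kst.
      by rewrite -(ki s)// -(ki t)// kst.
    + exists i; split; first by move=> s /=; rewrite in_itv/=; exact: ki.
      rewrite kU; apply: withinU_continuous; try exact: arc_closed.
        apply: (@subspace_eq_continuous _ _ _ (mdist x)).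
          by move=> w /set_mem/ixm.
        exact/continuous_subspaceT/mdist_continuous.
      apply: (@subspace_eq_continuous _ _ _ (fun w => a + mdist m w)).
        by move=> w /set_mem/imy.
      apply: continuous_subspaceT => w.
      by apply: cvgD; [exact: cvg_cst|exact: mdist_continuous].
  - by rewrite kf.
  - by rewrite kg ?lerDl// addrC addKr.
have : (k @` `[0, a + b]) m.
  by rewrite kU; left; exact: (tree_arc_ends x m).2.
by rewrite (is_arc_tree_arc karc) tree_arcE.
Qed.

End RTree.

(** * Tree orders *)

Section TreeOrder.
Context {X : Type} (le : X -> X -> Prop)
  (le_refl : forall x, le x x)
  (le_trans : forall x y z, le x y -> le y z -> le x z)
  (below_chain : forall x y z, le x z -> le y z -> le x y \/ le y x).

Definition chain (A : set X) : Prop :=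
  forall x y, A x -> A y -> le x y \/ le y x.

Lemma terminalP x : terminal le x <-> forall y, ~ strictly_below le x y.
Proof.
split => [xt y xy|xt].
  suff : components le x [set z | strictly_below le x z /\ same_component le x y z].
    by rewrite xt.
  by exists y.
by apply/seteqP; split => // C [y /xt].
Qed.

Lemma branching_intro x y z : strictly_below le x y -> strictly_below le x z ->
  ~ same_component le x y z -> branching le x.
Proof.
move=> xy xz nyz.
exists [set u | strictly_below le x u /\ same_component le x y u].
exists [set u | strictly_below le x u /\ same_component le x z u].
split; [by exists y|by exists z|].
move=> E; have : [set u | strictly_below le x u /\ same_component le x y u] z.
  by rewrite E; split => //; exists z.
by case.
Qed.

(** Different classes have inequivalent representatives once [same_component] is transitive, which
    is where comparability below a common element enters. *)
Lemma branching_elim x : branching le x -> exists y z,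
  [/\ strictly_below le x y, strictly_below le x z & ~ same_component le x y z].
Proof.
move=> [_ [_ [[y xy ->] [z xz ->] CD]]]; exists y, z; split => //.
move=> yz; apply: CD.
have sub u v w : same_component le x u v -> same_component le x u w ->
    same_component le x v w.
  move=> [a [xa au av]] [b [xb bu bw]].
  have [ab|ba] := below_chain au bu; [exists a|exists b]; split => //.
    exact: le_trans bw.
  exact: le_trans av.
have zy : same_component le x z y by have [a [? ? ?]] := yz; exists a.
apply/seteqP; split => u /= [xu H]; split => //; [exact: (sub y)|exact: (sub z)].
Qed.

(** An element of a member is above [x], hence in every member, or below [x], where all elements are
    comparable. *)
Lemma upwards_closed_chain_bigcup x (F : set (set X)) :
  (forall A, F A -> [/\ A x, upwards_closed le A & chain A]) ->
  upwards_closed le (\bigcup_(A in F) A) /\ chain (\bigcup_(A in F) A).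
Proof.
move=> FA; split => [y z [A AF Ay] yz|y z [A AF Ay] [B BF Bz]].
  by exists A => //; have [_ Au _] := FA _ AF; exact: Au yz.
have [Ax Au Ac] := FA _ AF; have [Bx Bu Bc] := FA _ BF.
have [xy|yx] := Ac _ _ Ax Ay; first exact: Bc (Bu _ _ Bx xy) Bz.
have [xz|zx] := Bc _ _ Bx Bz; first exact: Ac Ay (Au _ _ Ax xz).
exact: below_chain yx zx.
Qed.

Lemma iso_to_real_interval_chain (R : realType) (A : set X) :
  iso_to_real_interval le R A -> chain A.
Proof.
move=> [I [f [_ _ [_ _ fA] fle]]] x y /fA[s Is <-] /fA[t It <-].
have [st|/ltW ts] := leP s t; [left|right]; exact/fle.
Qed.

Lemma iso_to_real_interval_nontrivial (R : realType) (A : set X) :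
  iso_to_real_interval le R A -> exists x y, [/\ A x, A y & strictly_below le x y].
Proof.
move=> [I [f [_ [s [t [Is It st]]] [If finj _] fle]]].
exists (f s), (f t); split; [exact: If|exact: If|split].
  exact/fle/ltW.
by move=> /finj E; move: st; rewrite E ?inE// ltxx.
Qed.

End TreeOrder.

(** * The cut-point order *)

Section CutPointOrder.
Context {R : realType} {X : metricType R} (hX : R_tree X) (p : X).
Implicit Types x y z w : X.
Local Notation le := (cut_le p).
Local Notation h := (mdist p).

Lemma cut_leE x y : le x y <-> h x + mdist x y = h y.
Proof.
rewrite /cut_le !(tree_arcE hX); split => [/(_ x)/=|xy z /= zx].
  by rewrite mdistxx addr0; exact.
have := metric_triangle z x y; have := metric_triangle p z y; lra.
Qed.

Lemma cut_le_refl x : le x x. Proof. exact: subset_refl. Qed.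

Lemma cut_le_trans x y z : le x y -> le y z -> le x z.
Proof. exact: subset_trans. Qed.

Lemma root_cut_le x : le p x.
Proof. by apply/cut_leE; rewrite mdistxx add0r. Qed.

Lemma cut_le_height x y : le x y -> h x <= h y.
Proof. by move=> /cut_leE <-; rewrite lerDl mdist_ge0. Qed.

Lemma cut_le_height_eq x y : le x y -> h y <= h x -> x = y.
Proof.
move=> /cut_leE xy yx; apply: mdist_positivity.
have := mdist_ge0 x y; lra.
Qed.

Lemma cut_le_anti x y : le x y -> le y x -> x = y.
Proof. by move=> xy /cut_le_height; exact: cut_le_height_eq. Qed.

Lemma strictly_below_height x y : strictly_below le x y -> h x < h y.
Proof.
move=> [xy ne]; rewrite lt_neqAle cut_le_height// andbT.
by apply/eqP => E; apply: ne; apply: cut_le_height_eq; rewrite ?E.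
Qed.

(** All points below [z] lie on one geodesic from [p], with their heights as parameters. *)
Lemma cut_le_below x y z : le x z -> le y z -> h x <= h y -> le x y.
Proof.
have [f gf] := geodesic_exists hX p z; have [f0 fd fi] := gf.
have inarc u : le u z -> exists2 s, 0 <= s <= h z & f s = u.
  move=> /cut_leE uz; have : tree_arc p z u by rewrite (tree_arcE hX).
  by rewrite (tree_arc_geodesic hX gf) => -[s /=]; rewrite in_itv/=; exists s.
move=> /inarc[s hs <-] /inarc[t ht <-]; rewrite cut_leE fi//.
have [-> _] := geodesic_dist gf hs; have [-> _] := geodesic_dist gf ht.
by move=> st; rewrite distrC ger0_norm ?subr_ge0// addrC subrK.
Qed.

Lemma cut_le_below_chain x y z : le x z -> le y z -> le x y \/ le y x.
Proof.
move=> xz yz; have [xy|/ltW yx] := leP (h x) (h y).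
  by left; exact: cut_le_below xz yz xy.
by right; exact: cut_le_below yz xz yx.
Qed.

Lemma cut_le_point x s : 0 <= s <= h x -> exists2 y, le y x & h y = s.
Proof.
move=> hs; have [y yE yx] := arc_point hX hs.
by exists y => //; apply/cut_leE; lra.
Qed.

Lemma strictly_below_point x y s : strictly_below le x y -> h x < s <= h y ->
  exists z, [/\ strictly_below le x z, le z y & h z = s].
Proof.
move=> [xy _] /andP[xs sy]; have x0 := mdist_ge0 p x.
have [|z zy zs] := @cut_le_point y s; first by apply/andP; split; lra.
exists z; split => //; split; first by apply: (cut_le_below xy zy); lra.
by move=> E; move: xs; rewrite E zs ltxx.
Qed.

(** * Meets *)

(** The meet is the point below [y] whose height is the supremum of the heights of common lower
    bounds. *)
Lemma cut_meet y z : exists m,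
  [/\ le m y, le m z & forall w, le w y -> le w z -> le w m].
Proof.
pose E : set R := [set s | exists w, [/\ le w y, le w z & h w = s]].
have E0 : E 0 by exists p; split; [exact: root_cut_le|exact: root_cut_le|exact: mdistxx].
have ubE : ubound E (h y) by move=> s [w [wy _ <-]]; exact: cut_le_height.
have hE : has_sup E by split; [exists 0|exists (h y)].
have supy : sup E <= h y by apply: ge_sup => //; exists 0.
have sup0 : 0 <= sup E by exact: ub_le_sup hE.2 _ E0.
have [|m my ms] := @cut_le_point y (sup E); first by rewrite sup0 supy.
have below w : le w y -> le w z -> le w m.
  move=> wy wz; apply: (cut_le_below wy my); rewrite ms.
  by apply: ub_le_sup hE.2 _ _; exists w.
exists m; split => //; apply/cut_leE/eqP; rewrite eq_le metric_triangle andbT.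
apply/ler_addgt0Pr => e e0; have e20 : 0 < e / 2 by rewrite divr_gt0.
(* [w] is less than [e / 2] below [m] in height; a detour from [m] to [z] through [w] loses this
   amount twice. *)
have [_ [w [wy wz <-]]] := sup_adherent e20 hE; rewrite -ms => wm.
have /cut_leE wm' := below _ wy wz; move: wz => /cut_leE wz.
have := metric_triangle m w z; rewrite (metric_sym m w) => h1.
have -> : e = e / 2 + e / 2 by rewrite -splitr.
lra.
Qed.

(** A point [w] common to [[y, m]] and [[m, z]] lies below [y] and [z], hence below [m]; as its
    height is [h m + mdist m w], it is [m]. *)
Lemma mdist_meet y z m : le m y -> le m z ->
  (forall w, le w y -> le w z -> le w m) -> mdist y m + mdist m z = mdist y z.
Proof.
move=> my mz glb; apply: (concat_mdist hX) => w.
rewrite !(tree_arcE hX) /= => ymw mwz.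
move: (my) (mz) => /cut_leE hmy /cut_leE hmz.
have above u : le m u -> mdist m w + mdist w u = mdist m u ->
    le w u /\ h w = h m + mdist m w.
  move=> /cut_leE mu mwu; have := metric_triangle p m w.
  have := metric_triangle p w u; rewrite cut_leE; lra.
have [|wy hw] := above y my.
  by rewrite addrC metric_sym (metric_sym m w) (metric_sym m y).
have [wz _] := above z mz mwz.
have /cut_le_height := glb _ wy wz; rewrite hw => hle.
by apply/esym/mdist_positivity; have := mdist_ge0 m w; lra.
Qed.

(* Only here, through mdist_meet, is uniqueness of arcs used beyond geodesics. *)
Lemma cut_le_near x y z : le x y -> mdist y z < mdist x y -> le x z.
Proof.
move=> xy yz; have [m [my mz glb]] := cut_meet y z.
have E := mdist_meet my mz glb.
(* If [m] were below [x], the way from [y] to [z] through [m] would have length at least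
   [mdist x y]. *)
have [xm|mx] := cut_le_below_chain xy my; first exact: cut_le_trans mz.
move: xy my mx => /cut_leE xy /cut_leE my /cut_leE mx.
have := mdist_ge0 m z; have := mdist_ge0 m x; rewrite (metric_sym y m) in E.
lra.
Qed.

(** * Topology of up-sets and noncut-points *)

Lemma open_above x : open [set y | strictly_below le x y].
Proof.
rewrite openE => y [xy /eqP]; rewrite -mdist_gt0 => ne.
apply/nbhs_ballP; exists (mdist x y) => //= z; rewrite ballEmdist /= => yz.
split; first exact: cut_le_near yz.
by move=> E; move: yz; rewrite -E metric_sym ltxx.
Qed.

Lemma closed_above x : closed [set y | le x y].
Proof.
have -> : [set y | le x y] = (fun y => h y - mdist x y) @^-1` [set h x].
  by apply/seteqP; split => y /=; rewrite cut_leE => E; lra.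
apply: preimage_closed; last exact: closed_eq.
by move=> y _; apply: cvgB; exact: mdist_continuous.
Qed.

(** The points strictly above [x] are clopen in the complement of [x]. If there were any,
    connectedness would make them all of it, but the root is not among them. *)
Lemma noncut_point_terminal x : x <> p -> noncut_point x -> terminal le x.
Proof.
move=> xp xnc; apply/terminalP => y xy.
suff : [set z | strictly_below le x z] = ~` [set x].
  move=> E; have : (~` [set x]) p by move=> /= ?; exact: xp.
  by rewrite -E => -[/cut_le_anti/(_ (root_cut_le x))].
apply: xnc; first by exists y.
- exists [set z | strictly_below le x z]; first exact: open_above.
  by apply/seteqP; split => z /= => [[xz ne]|[]//]; split => // /esym.
- exists [set z | le x z]; first exact: closed_above.
  apply/seteqP; split => z /= [xz ne]; first by split => // /esym.
  by split => // /esym.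
Qed.

(** The complement of [x] is the union of the arcs from [p] to its points; none passes through [x],
    since nothing lies above [x]. *)
Lemma terminal_noncut_point x : x <> p -> terminal le x -> noncut_point x.
Proof.
move=> xp /terminalP xt; rewrite /noncut_point.
have -> : ~` [set x] = \bigcup_(y in ~` [set x]) tree_arc p y.
  apply/seteqP; split => [y yx|w [y yx]].
    by exists y => //; exact: (tree_arc_ends hX p y).2.
  rewrite (tree_arcE hX) => /cut_leE wy /= wx.
  by apply: (xt y); split; [rewrite -wx|move=> E; apply: yx].
apply: bigcup_connected.
  by exists p => y _; exact: (tree_arc_ends hX p y).1.
move=> y _; have [f gf] := geodesic_exists hX p y.
rewrite (tree_arc_geodesic hX gf); apply: connected_continuous_connected.
  exact: segment_connected.
have [_ _ fi] := gf; apply: isometric_continuous => s t /=.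
by rewrite !in_itv/=; exact: fi.
Qed.

(** * Antichains and points of rational height *)

Lemma antichain_level s : antichain le [set x | h x = s].
Proof.
by move=> x y /= hx hy ne; split => /cut_le_height_eq E; apply: ne;
   [|apply/esym]; apply: E; rewrite hx hy.
Qed.

Lemma antichain_terminal : antichain le [set x | terminal le x].
Proof.
by move=> x y /terminalP xt /terminalP yt ne; split => E;
  [apply: (xt y)|apply: (yt x)]; split => // /esym.
Qed.

Definition rational_levels : set X := \bigcup_q [set x | h x = ratr q].

Lemma countable_rational_levels : ccc le -> countable rational_levels.
Proof.
by move=> C; apply: bigcup_countable => // q _; apply/C/antichain_level.
Qed.

Lemma rational_point x y : strictly_below le x y ->
  exists z, [/\ strictly_below le x z, le z y & rational_levels z].
Proof.
move=> xy; have [q] := rat_in_itvoo (strictly_below_height xy).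
rewrite in_itv/= => /andP[xq /ltW qy].
have [|z [xz zy zq]] := strictly_below_point xy (s := ratr q).
  by rewrite xq.
by exists z; split => //; exists q.
Qed.

Lemma dense_rational_levels : dense rational_levels.
Proof.
move=> O [x Ox]; rewrite openE => /(_ _ Ox) /nbhs_ballP[d d0 xO].
have [e [e0 {}xO]] : exists e : R, 0 < e / 2 /\ forall z, mdist x z < e -> O z.
  exists d; split; first exact: divr_gt0.
  by move=> z xz; apply: xO; rewrite ballEmdist.
have [xp|/eqP xp] := pselect (x = p).
  by exists x; split => //; exists 0 => //=; rewrite xp mdistxx raddf0.
rewrite -mdist_gt0 metric_sym in xp.
(* [h x - e / 2], cut off at the height 0 of the root; points below [x] and higher than [s] are
   within [e] of [x]. *)
have [s [s0 sx sd]] : exists s : R, [/\ 0 <= s, s < h x & h x - s < e].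
  have [hxe|ehx] := ltP (h x) (e / 2); [exists 0|exists (h x - e / 2)]; split; lra.
have [|y yx hy] := @cut_le_point x s; first by rewrite s0 ltW.
have yx' : strictly_below le y x.
  by split => // E; move: sx; rewrite -hy E ltxx.
have [z [yz zx zD]] := rational_point yx'.
exists z; split => //; apply: xO.
move/strictly_below_height: yz; rewrite hy.
by move/cut_leE: zx; rewrite (metric_sym x z); lra.
Qed.

(** Rational points from two components above a branching node determine it: of two nodes sharing
    such a pair, the lower would have both points in one component, through the upper. *)
Lemma countable_branching : ccc le -> countable [set x | branching le x].
Proof.
move=> C; have cD := countable_rational_levels C.
pose r x (yz : X * X) := [/\ strictly_below le x yz.1, strictly_below le x yz.2
  & ~ same_component le x yz.1 yz.2].
apply: (@countable_sub_rel _ _ _ _ r (countableX cD cD)).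
  move=> x /(branching_elim cut_le_trans cut_le_below_chain).
  move=> [y [z [xy xz nyz]]].
  have [y' [xy' yy' Dy']] := rational_point xy.
  have [z' [xz' zz' Dz']] := rational_point xz.
  exists (y', z') => //; split => //= -[w [xw wy wz]]; apply: nyz; exists w.
  by split => //; [exact: cut_le_trans yy'|exact: cut_le_trans zz'].
move=> x x' [y z] _ _ [/= [xy xy1] [xz xz1] n] [/= [x'y x'y1] [x'z x'z1] n'].
apply: contrapT => ne; have [xx'|x'x] := cut_le_below_chain xy x'y.
  by apply: n; exists x'.
by apply: n'; exists x; split => //; split => // /esym.
Qed.

(** * Twigs *)

(** The height is the isomorphism. Twigs can thus be handled as maximal chains, which are easier to
    unite than intervals. *)
Lemma chain_iso_to_real_interval (A : set X) : upwards_closed le A ->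
  chain le A -> (exists x y, [/\ A x, A y & strictly_below le x y]) ->
  iso_to_real_interval le R A.
Proof.
move=> Au Ac [x0 [y0 [Ax0 Ay0 xy0]]].
(* [f] inverts the height on [A]; elsewhere its values are arbitrary. *)
have /choice[f fP] : forall s, exists x, (h @` A) s -> A x /\ h x = s.
  move=> s; have [[x Ax <-]|ns] := pselect ((h @` A) s); first by exists x.
  by exists x0.
exists (h @` A), f; split.
- move=> _ _ [a Aa <-] [b Ab <-] c /andP[ac cb].
  have a0 := mdist_ge0 p a.
  have [|x xb hx] := @cut_le_point b c; first by apply/andP; split; lra.
  exists x => //; apply: (Au a) => //.
  have [ab|ba] := Ac _ _ Aa Ab; first by apply: (cut_le_below ab xb); rewrite hx.
  (* With [b] below [a] the bounds on [c] make all heights equal, so [x] is [b]. *)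
  have E : b = a by apply: (cut_le_height_eq ba); exact: le_trans ac cb.
  have bx : h b <= h x by rewrite hx E.
  by rewrite -E (cut_le_height_eq xb bx); exact: cut_le_refl.
- exists (h x0), (h y0); split; [by exists x0|by exists y0|].
  exact: strictly_below_height.
- split.
  + by move=> s /fP[].
  + by move=> s t /set_mem/fP[_ {2}<-] /set_mem/fP[_ {2}<-] ->.
  + move=> x Ax; exists (h x); first by exists x.
    have [Afx hfx] := fP (h x) (ex_intro2 _ _ x Ax erefl).
    have [E|E] := Ac _ _ Afx Ax; first by apply: (cut_le_height_eq E); rewrite hfx.
    by apply/esym/(cut_le_height_eq E); rewrite hfx.
- move=> s t /fP[As hs] /fP[At ht]; split.
    by move=> /cut_le_height; rewrite hs ht.
  move=> st; have [//|E] := Ac _ _ As At.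
  by rewrite (cut_le_height_eq E) ?hs ?ht//; exact: cut_le_refl.
Qed.

Lemma twig_chain (T : set X) : twig le R T -> chain le T.
Proof. by move=> [_ /iso_to_real_interval_chain]. Qed.

(** The union of all upwards-closed chains through [x] is itself one, so it is the largest; Zorn's
    lemma is avoided. *)
Lemma twig_exists x (A : set X) : A x -> upwards_closed le A -> chain le A ->
  (exists y z, [/\ A y, A z & strictly_below le y z]) ->
  exists2 T, twig le R T & T x.
Proof.
move=> Ax Au Ac [y [z [Ay Az yz]]].
pose F : set (set X) := [set B | [/\ B x, upwards_closed le B & chain le B]].
have [Uu Uc] := @upwards_closed_chain_bigcup _ le cut_le_below_chain x F
  (fun B FB => FB).
have FA : F A by [].
exists (\bigcup_(B in F) B); last by exists A.
split => //.
  by apply: chain_iso_to_real_interval => //; exists y, z; split => //; exists A.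
move=> B Bu /iso_to_real_interval_chain Bc UB; apply/seteqP; split => //.
by move=> u Bu'; exists B => //; split => //; apply: UB; exists A.
Qed.

(** The union of the two is an interval again, so maximality makes it equal to each. *)
Lemma twig_meet_eq (T T' : set X) x : twig le R T -> twig le R T' ->
  T x -> T' x -> T = T'.
Proof.
move=> tT tT' Tx T'x.
pose F : set (set X) := [set B | B = T \/ B = T'].
have [B|Uu Uc] := @upwards_closed_chain_bigcup _ le cut_le_below_chain x F.
  by case=> ->; split => //; [case: tT|exact: twig_chain|case: tT'|exact: twig_chain].
have sub B : F B -> twig le R B -> \bigcup_(B in F) B = B.
  move=> FB [Bu Bi]; apply => //; last by move=> u Bu'; exists B.
  apply: chain_iso_to_real_interval => //.
  have [y [z [By Bz yz]]] := iso_to_real_interval_nontrivial Bi.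
  by exists y, z; split => //; exists B.
by rewrite -(sub T) ?(sub T')//; [right|left].
Qed.

Lemma countable_twig : ccc le -> countable [set A | twig le R A].
Proof.
move=> C; apply: (@countable_sub_rel _ _ _ _ (fun T x => T x)
  (countable_rational_levels C)).
  move=> T [Tu Ti _]; have [x [y [Tx _ xy]]] := iso_to_real_interval_nontrivial Ti.
  have [z [[xz _] _ Dz]] := rational_point xy.
  by exists z => //; exact: Tu xz.
by move=> T T' x tT tT' Tx T'x; exact: (twig_meet_eq tT tT' Tx T'x).
Qed.

(** * Countable wispiness and ccc *)

(** The meet branches: a witness that [y] and [z] share a component above it would be a common lower
    bound strictly above the meet. *)
Lemma incomparable_branching x y z : le x y -> le x z -> ~ le y z -> ~ le z y ->
  exists2 m, le x m & branching le m.
Proof.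
move=> xy xz nyz nzy; have [m [my mz glb]] := cut_meet y z.
exists m; first exact: glb.
apply: (branching_intro cut_le_refl (y := y) (z := z)).
- by split => // E; apply: nyz; rewrite -E.
- by split => // E; apply: nzy; rewrite -E.
- by move=> [w [[mw ne] wy wz]]; exact/ne/cut_le_anti/glb.
Qed.

Lemma ccc_of_countably_wispy : countably_wispy le R ->
  countable [set x | terminal le x] -> ccc le.
Proof.
move=> [cB cT] ct A anti.
have below_eq x x' z : A x -> A x' -> le x z -> le x' z -> x = x'.
  move=> Ax Ax' xz x'z; apply: contrapT => /(anti _ _ Ax Ax')[n n'].
  by have [] := cut_le_below_chain xz x'z.
pose A1 := A `&` [set x | exists2 b, branching le b & le x b].
have cA1 : countable A1.
  apply: (@countable_sub_rel _ _ _ _ le cB) => [x [_ [b]]|]; first by exists b.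
  by move=> x x' b [Ax _] [Ax' _]; exact: below_eq.
pose A2 := A `&` [set x | exists2 T, twig le R T & T x].
have cA2 : countable A2.
  apply: (@countable_sub_rel _ _ _ _ (fun x T => twig le R T /\ T x) cT).
    by move=> x [_ [T]]; exists T.
  move=> x x' T [Ax _] [Ax' _] [tT Tx] [_ Tx'].
  apply: contrapT => /(anti _ _ Ax Ax')[n n'].
  by have [] := twig_chain tT Tx Tx'.
apply: (subset_countable _ (countableU (countableU cA1 cA2) ct)) => x Ax.
have [xt|nt] := pselect (terminal le x); first by right.
left; have [xb|nb] := pselect (exists2 b, branching le b & le x b).
  by left; split.
(* No node from [x] upwards branches, so the up-set of [x] is a chain, and it extends to a twig. *)
right; split => //; apply: (@twig_exists x [set y | le x y]).
- exact: cut_le_refl.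
- by move=> y z /=; exact: cut_le_trans.
- move=> y z /= xy xz; apply: contrapT => /not_orP[nyz nzy].
  by apply: nb; have [m xm mb] := incomparable_branching xy xz nyz nzy; exists m.
- have [y xy] : exists y, strictly_below le x y.
    by apply: contrapT => /forallNP xt; exact/nt/terminalP.
  by exists x, y; split => //; case: xy.
Qed.

Lemma countably_wispy_of_ccc : ccc le ->
  countably_wispy le R /\ countable [set x | terminal le x].
Proof.
move=> C; split; last exact/C/antichain_terminal.
by split; [exact: countable_branching|exact: countable_twig].
Qed.

(** * Separability and ccc *)

Lemma ccc_of_separable : separable_space X ->
  countable [set x : X | noncut_point x] -> ccc le.
Proof.
move=> [D [cD dD]] cN A anti.
pose A' := A `&` [set x | exists y, strictly_below le x y].
have cA' : countable A'.
  apply: (@countable_sub_rel _ _ _ _ le cD) => [x [_ xy]|].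
    by have [y [[] ? _ ?]] := dD _ xy (open_above x); exists y.
  move=> x x' z [Ax _] [Ax' _] xz x'z.
  apply: contrapT => /(anti _ _ Ax Ax')[n n'].
  by have [] := cut_le_below_chain xz x'z.
(* An element of [A] outside [A'] is terminal, hence a noncut-point unless it is the root. *)
apply: (subset_countable _ (countableU (countableU (countable1 p) cN) cA')).
move=> x Ax; have [xp|xp] := pselect (x = p); first by left; left.
have [xy|nxy] := pselect (exists y, strictly_below le x y); first by right.
by left; right; apply/terminal_noncut_point/terminalP => // y xy; apply: nxy; exists y.
Qed.

Lemma separable_of_ccc : ccc le ->
  separable_space X /\ countable [set x : X | noncut_point x].
Proof.
move=> C; split.
  exists rational_levels; split; first exact: countable_rational_levels.
  exact: dense_rational_levels.
apply: (subset_countable _ (countableU (countable1 p) (C _ antichain_terminal))).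
move=> x xnc; have [xp|xp] := pselect (x = p); first by left.
by right; exact: noncut_point_terminal.
Qed.

End CutPointOrder.

(** * From a fixed root to all roots *)

Theorem theorem6p4 (R : realType) (X : metricType R) (hX : R_tree X) :
  let cond1 := separable_space X /\ countable [set x : X | noncut_point x] in
  let cond2 := forall p : X,
    countably_wispy (cut_le p) R /\
    countable [set x : X | terminal (cut_le p) x] in
  let cond3 := forall p : X, ccc (cut_le p) in
  (cond1 <-> cond2) /\ (cond2 <-> cond3).
Proof.
move=> cond1 cond2 cond3.
have c23 : cond2 <-> cond3.
  split => C p; last exact/(countably_wispy_of_ccc hX)/C.
  by have [] := C p; exact: ccc_of_countably_wispy.
have c13 : cond1 <-> cond3.
  split => [[sX cN] p|C]; first exact: ccc_of_separable.
  (* Passing back to [cond1] takes some root; in the empty space [cond1] holds trivially. *)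
  have [[p _]|X0] := pselect (exists p : X, True).
    exact: (separable_of_ccc hX (C p)).
  have E (A : set X) : A = set0.
    by apply/seteqP; split => // x _; apply: X0; exists x.
  split; last by rewrite (E [set _ | _]).
  by exists set0; split => // O [x _]; case: X0; exists x.
by split; [rewrite c13 c23|].
Qed.
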